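(* Let $k$ be a field, and let $B$ and $C$ be nonzero finite-dimensional vector spaces over $k$. Suppose $A\subseteq B\otimes_k C$ is a $k$-subspace such that $$(\forall\, b\in B\setminus\{0\})\ (\exists\, c\in C\setminus\{0\})\quad b\otimes c\in A,$$ and $$(\forall\, c\in C\setminus\{0\})\ (\exists\, b\in B\setminus\{0\})\quad b\otimes c\in A.$$ Then $$\dim_k(A)\ \geq\ \dim_k(B)+\dim_k(C)-1.$$ *)

(* Defs.v *)
From mathcomp Require Import all_boot all_order all_algebra.
From HB Require Import structures.

Set Implicit Arguments.
Unset Strict Implicit.
Unset Printing Implicit Defensive.

Import GRing.Theory.
Local Open Scope ring_scope.

(* W ranges over all k-vector spaces, not only finite-dimensional ones. *)
Definition is_tensor_product (k : fieldType) (B C T : lmodType k)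
    (t : {bilinear B -> C -> T}) : Prop :=
  forall (W : lmodType k) (f : {bilinear B -> C -> W}),
    exists g : {linear T -> W},
      (forall b c, g (t b c) = f b c) /\
      (forall g' : {linear T -> W}, (forall b c, g' (t b c) = f b c) -> g' =1 g).

(* Existence, for finite-dimensional B and C, of a tensor product carried by a
   vectType; is_tensor_product determines it up to unique isomorphism. *)
Section Existence.
Variables (k : fieldType) (B C : vectType k).

Definition tens_mx (b : B) (c : C) : 'M[k]_(\dim {:B}, \dim {:C}) :=
  \matrix_(i, j) (coord (vbasis {:B}) i b * coord (vbasis {:C}) j c).

Fact tens_mx_bilinear : bilinear_for *:%R *:%R tens_mx.
Proof.
split=> u a x y; apply/matrixP=> i j; rewrite !mxE linearP.
  by rewrite mulrDl mulrA.
by rewrite mulrDr mulrCA.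
Qed.

HB.instance Definition _ := bilinear_isBilinear.Build k B C
  'M[k]_(\dim {:B}, \dim {:C}) *:%R *:%R tens_mx tens_mx_bilinear.

Lemma tens_mx_is_tensor_product : is_tensor_product tens_mx.
Proof.
move=> W f.
pose e i := (vbasis {:B})`_i; pose e' j := (vbasis {:C})`_j.
pose g (M : 'M[k]_(\dim {:B}, \dim {:C})) : W :=
  \sum_i \sum_j M i j *: f (e i) (e' j).
have g_lin : linear g.
  move=> a M N; rewrite /g scaler_sumr -big_split; apply: eq_bigr => i _ /=.
  rewrite scaler_sumr -big_split; apply: eq_bigr => j _ /=.
  by rewrite !mxE scalerDl scalerA.
pose gL := GRing.isLinear.Build k _ W *:%R g g_lin.
pose G : {linear 'M[k]_(\dim {:B}, \dim {:C}) -> W} := HB.pack g gL.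
exists G; split.
  move=> b c; rewrite /= {2}(coord_vbasis (memvf b)) linear_sumlz.
  apply: eq_bigr => i _.
  rewrite linearZl_LR {2}(coord_vbasis (memvf c)) linear_sumr scaler_sumr.
  by apply: eq_bigr => j _; rewrite linearZr_LR scalerA mxE.
move=> g' g'E M; rewrite {1}[M]matrix_sum_delta linear_sum /=.
apply: eq_bigr => i _; rewrite linear_sum; apply: eq_bigr => j _ /=.
rewrite linearZ -g'E; congr (_ *: g' _); apply/matrixP=> i' j'; rewrite !mxE.
rewrite !coord_free ?(basis_free (vbasisP _)) //.
by rewrite -natrM mulnb (eq_sym i) (eq_sym j).
Qed.

End Existence.

(* Main.v *)
(* Call a finite family of pure tensors b_i (x) c_i good if it spans a space of
   dimension at least dim <b_i> + dim <c_i> - 1; single tensors are good.  If the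
   span of a good family U meets the span of other pure tensors of A, a minimal
   such coincidence enlarges U to a bigger good family, by Sylvester's rank
   inequality.  Splitting off maximal good families therefore yields good
   families U_1, ..., U_h of pure tensors of A with independent spans, such that
   every b lies in some L_j = <b_i : i in U_j> and every c in some
   R_j = <c_i : i in U_j>.  Hence dim A >= sum_j (dim L_j + dim R_j - 1).

   Subspaces covering B either include B itself, or have dimensions adding up to
   at least 2 dim B - 1.  Say dim C <= dim B.  In the first case
   sum_j (dim L_j - 1) >= dim B - 1 and sum_j dim R_j >= dim C; in the second one
   the sum is at least 2 dim B - 1 >= dim B + dim C - 1, since dim R_j >= 1. *)
Require Import Defs.
From mathcomp Require Import all_boot all_order all_algebra.
From mathcomp Require Import zify ring.
From Stdlib Require Import Classical.
Local Open Scope ring_scope.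
Set Implicit Arguments.
Unset Strict Implicit.
Unset Printing Implicit Defensive.
Import GRing.Theory.

(** * Spans of finite families of row vectors *)

Section Span.
Variables (k : fieldType) (I : eqType) (p : nat) (f : I -> 'rV[k]_p).
Implicit Types s : seq I.

Definition spanmx s : 'M[k]_p := (\sum_(i <- s) <<f i>>)%MS.

Lemma spanmx_cons i s : spanmx (i :: s) = (<<f i>> + spanmx s)%MS.
Proof. by rewrite /spanmx big_cons. Qed.

Lemma spanmx_cat s1 s2 : spanmx (s1 ++ s2) = (spanmx s1 + spanmx s2)%MS.
Proof. by rewrite /spanmx big_cat. Qed.

Lemma spanmx_sub q (W : 'M[k]_(q, p)) s :
  (spanmx s <= W)%MS = all (fun i => f i <= W)%MS s.
Proof.
elim: s => [|i s IH]; first by rewrite /spanmx big_nil sub0mx.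
by rewrite spanmx_cons addsmx_sub genmxE IH.
Qed.

Lemma mem_spanmx i s : i \in s -> (f i <= spanmx s)%MS.
Proof.
by move=> si; have:= submx_refl (spanmx s); rewrite spanmx_sub => /allP; apply.
Qed.

(** One row per position of [s], repetitions included, so that a linear relation is a row vector of
    coefficients. *)
Definition rowsmx s : 'M[k]_(size s, p) := \matrix_j f (tnth (in_tuple s) j).

Lemma spanmxE s : (spanmx s :=: rowsmx s)%MS.
Proof.
apply/eqmxP/andP; split.
  rewrite spanmx_sub; apply/allP=> i /(tnthP (in_tuple s))[j ->].
  by rewrite (_ : f _ = row j (rowsmx s)) ?row_sub // rowK.
by apply/row_subP=> j; rewrite rowK mem_spanmx // mem_tnth.
Qed.

Lemma rank_spanmx_size s : (\rank (spanmx s) <= size s)%N.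
Proof. by rewrite spanmxE rank_leq_row. Qed.

Lemma spanmx_basis s : exists s', [/\ {subset s' <= s},
  (size s' <= \rank (spanmx s))%N & (spanmx s <= spanmx s')%MS].
Proof.
elim: s => [|i s [s' [s's szs' ss']]].
  by exists [::]; split=> //; rewrite /spanmx big_nil sub0mx.
have [fi|fi] := boolP (f i <= spanmx s)%MS.
  exists s'; split; first by move=> j /s's; rewrite inE orbC => ->.
    by rewrite (leq_trans szs') // mxrankS // spanmx_cons addsmxSr.
  by rewrite spanmx_cons addsmx_sub genmxE (submx_trans fi).
exists (i :: s'); split.
- by move=> j; rewrite !inE => /orP[->//|/s's ->]; rewrite orbT.
- have: (spanmx s < spanmx (i :: s))%MS.
    by rewrite ltmxE spanmx_cons addsmxSr addsmx_sub genmxE negb_and fi.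
  by rewrite ltmxErank => /andP[_]; apply: leq_ltn_trans.
- by rewrite !spanmx_cons addsmxS.
Qed.

Lemma row_combination_sub s (u : 'rV[k]_(size s)) s' :
    (forall j, u 0 j != 0 -> tnth (in_tuple s) j \in s') ->
  (u *m rowsmx s <= spanmx s')%MS.
Proof.
move=> us'; rewrite mulmx_sum_row summx_sub // => j _.
have [->|uj] := eqVneq (u 0 j) 0; first by rewrite scale0r sub0mx.
by rewrite scalemx_sub // rowK mem_spanmx // us'.
Qed.

End Span.

(** * Coverings of a vector space by subspaces *)

Section Covering.
Variables (k : fieldType) (m : nat).
Implicit Types (V H W : 'M[k]_m) (Ws : seq 'M[k]_m) (v : 'rV[k]_m).

Lemma rank_bigadds Ws : (\rank (\sum_(W <- Ws) W)%MS <= \sum_(W <- Ws) \rank W)%N.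
Proof.
elim: Ws => [|W Ws IH]; first by rewrite !big_nil mxrank0.
rewrite !big_cons; apply: leq_trans (mxrank_adds_leqif _ _) _.
by rewrite leq_add2l.
Qed.

Lemma sub_bigadds W Ws : W \in Ws -> (W <= \sum_(X <- Ws) X)%MS.
Proof. by move=> WWs; rewrite (big_rem W) //= addsmxSl. Qed.

(** Fix w in V outside H. A vector v of V in H is [(v + w) - w], a difference of two vectors of V
    outside H. *)
Lemma complement_spans V H W : (\rank H < \rank V)%N ->
  (forall v, (v <= V)%MS -> ~~ (v <= H)%MS -> (v <= W)%MS) -> (V <= W)%MS.
Proof.
move=> ltHV VW.
have: ~~ (V <= H)%MS by apply: contraL ltHV => /mxrankS; rewrite -leqNgt.
case/row_subPn=> i; move: (row i V) (row_sub i V) => w wV wH.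
apply/rV_subP=> v vV; have [vH|] := boolP (v <= H)%MS; last exact: VW.
rewrite -(addrK w v) addmx_sub // ?eqmx_opp ?VW //; first exact: addmx_sub.
by apply: contra wH => vwH; rewrite -(addKr v w) addmx_sub // eqmx_opp.
Qed.

Lemma hyperplane_line V H v : (H <= V)%MS -> (\rank V <= (\rank H).+1)%N ->
  (v <= V)%MS -> ~~ (v <= H)%MS -> (V <= H + v)%MS.
Proof.
move=> HV rV vV vH.
have: (H + v <= V)%MS by rewrite addsmx_sub HV.
move/mxrank_leqif_sup=> /geq_leqif <-; apply: leq_trans rV _.
have: (H < H + v)%MS by rewrite ltmxE addsmxSl addsmx_sub submx_refl.
by rewrite ltmxErank => /andP[].
Qed.

Lemma exists_hyperplane V : V != 0 ->
  exists2 H : 'M_m, (H <= V)%MS & \rank V = (\rank H).+1.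
Proof.
move=> V0; pose v : 'rV_m := nz_row V.
exists (V :\: v)%MS; first exact: diffmxSl.
have rv : \rank v = 1%N by rewrite rank_rV nz_row_eq0 V0.
have E : (v :=: V :&: v)%MS.
  by apply/eqmxP; rewrite capmxSr sub_capmx submx_refl nz_row_sub.
by rewrite -(mxrank_cap_compl V v) -E rv.
Qed.

(* Induction on \rank V: for a hyperplane H of V, the complement of H spans V, so
   at least two of the subspaces are needed to cover it, and these two lose a
   dimension when intersected with H.  If some W contains H, the other subspaces
   cover the complement of H, hence together span V. *)
Lemma covering_rank V Ws : V != 0 ->
    (forall v, (v <= V)%MS -> v != 0 -> exists2 W, W \in Ws & (v <= W)%MS) ->
  (exists2 W, W \in Ws & (V <= W)%MS) \/
  (2 * \rank V <= (\sum_(W <- Ws) \rank W).+1)%N.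
Proof.
have [r rV] : exists r, (\rank V <= r)%N by exists (\rank V).
elim: r V Ws rV => [|r IH] V Ws rV V0 covV.
  by move: V0; rewrite -mxrank_eq0 -leqn0 rV.
have [/hasP|/hasPn noV] := boolP (has (fun W => V <= W)%MS Ws); first by left.
right; have [H HV rVH] := exists_hyperplane V0.
have covVH v : (v <= V)%MS -> ~~ (v <= H)%MS -> exists2 W, W \in Ws & (v <= W)%MS.
  by move=> vV vH; apply: covV => //; apply: contraNneq vH => ->; rewrite sub0mx.
have [/hasP[W WWs HW]|/hasPn noH] := boolP (has (fun W => H <= W)%MS Ws).
  suff: (V <= \sum_(X <- rem W Ws) X)%MS.
    move/mxrankS/leq_trans/(_ (rank_bigadds _)).
    have := mxrankS HW; rewrite (big_rem W WWs) /= rVH; lia.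
  apply: (complement_spans (H := H)) => [|v vV vH]; first by rewrite rVH.
  have [X XWs vX] := covVH v vV vH.
  have: X \in W :: rem W Ws by rewrite -(perm_mem (perm_to_rem WWs)).
  rewrite inE => /predU1P[XW|XWs']; last exact: submx_trans vX (sub_bigadds XWs').
  case/negP: (noV W WWs); apply: submx_trans (hyperplane_line HV _ vV vH) _.
    by rewrite rVH.
  by rewrite addsmx_sub HW -XW.
(* The covering has at least one member, and it would contain H if H were 0. *)
have H0 : H != 0.
  apply/eqP=> H0; have [|W WWs _] := covV (nz_row V) (nz_row_sub V).
    by rewrite nz_row_eq0.
  by case/negP: (noH W WWs); rewrite H0 sub0mx.
have [||[W']|] := IH H [seq W :&: H | W <- Ws]%MS _ H0.
- by rewrite -ltnS -rVH.
- move=> v vH v0; have [W WWs vW] := covV v (submx_trans vH HV) v0.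
  by exists (W :&: H)%MS; [exact: map_f | rewrite sub_capmx vW].
- case/mapP=> W WWs -> HWH; case/negP: (noH W WWs).
  exact: submx_trans HWH (capmxSl _ _).
rewrite big_map => IHle.
pose p W := ~~ (W <= H)%MS.
have count_le : (\sum_(W <- Ws) \rank (W :&: H)%MS + count p Ws
               <= \sum_(W <- Ws) \rank W)%N.
  rewrite -sum1_count [X in (_ + X)%N]big_mkcond -big_split /=.
  apply: leq_sum => W _; have := mxrankS (capmxSl W H); rewrite /p.
  have [/=|WH _] := boolP (W <= H)%MS; first by rewrite addn0.
  rewrite addn1; have: (W :&: H < W)%MS.
    by rewrite ltmxE capmxSl sub_capmx submx_refl.
  by rewrite ltmxErank => /andP[].
suff: (1 < count p Ws)%N by move: count_le IHle; rewrite rVH; lia.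
have covp v : (v <= V)%MS -> ~~ (v <= H)%MS ->
    exists2 W, W \in filter p Ws & (v <= W)%MS.
  move=> vV vH; have [W WWs vW] := covVH v vV vH.
  exists W => //; rewrite mem_filter WWs andbT.
  by apply: contra vH; apply: submx_trans.
rewrite -size_filter; case Ep: (filter p Ws) covp => [|W [|//]] covp; exfalso.
  suff: (V <= H)%MS by move/mxrankS; rewrite rVH ltnn.
  by apply/rV_subP=> v vV; apply: contraT => /(covp v vV)[].
have WWs : W \in Ws by have:= mem_head W [::]; rewrite -Ep mem_filter => /andP[].
case/negP: (noV W WWs); apply: (complement_spans (H := H)) => [|v vV vH].
  by rewrite rVH.
by have [X] := covp v vV vH; rewrite inE => /eqP->.
Qed.

End Covering.

(** * Pure tensors as rank-one matrices, and good families *)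

Section Tensors.
Variables (k : fieldType) (m n : nat).
Notation pt := ('rV[k]_m * 'rV[k]_n)%type.
Implicit Types (p : pt) (s U : seq pt).

Definition tensor p : 'rV[k]_(m * n) := mxvec (p.1^T *m p.2).

Notation spanL := (spanmx (@fst 'rV[k]_m 'rV[k]_n)).
Notation spanR := (spanmx (@snd 'rV[k]_m 'rV[k]_n)).
Notation spanT := (spanmx tensor).

(** As a matrix, [tensor p] has its column space in the line of [p.1] and its row space in the line
    of [p.2]; both inclusions pass to linear combinations. *)
Lemma spanT_sub s (v : 'rV_(m * n)) : (v <= spanT s)%MS ->
  ((vec_mx v)^T <= spanL s)%MS /\ (vec_mx v <= spanR s)%MS.
Proof.
elim: s v => [|p s IH] v.
  by rewrite /spanmx big_nil submx0 => /eqP->; rewrite linear0 trmx0 !sub0mx.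
rewrite !spanmx_cons => /sub_addsmxP[[u1 u2] /= ->].
have [vL vR] := IH _ (submxMl u2 (spanT s)).
have : (u1 *m <<tensor p>> <= tensor p)%MS.
  by apply: submx_trans (submxMl _ _) _; rewrite genmxE.
case/sub_rVP=> a ->; rewrite linearD linearZ /= mxvecK linearD linearZ /= trmx_mul trmxK.
split; apply: addmx_sub_adds; rewrite ?genmxE //.
  by rewrite scalemx_sub // submxMl.
by rewrite scalemx_sub // submxMl.
Qed.

(** At a nonzero coordinate of [b], the row of [b^T *m c] is a nonzero multiple of [c]. *)
Lemma trmx_mul_rV q r (b : 'rV[k]_q) (c : 'rV[k]_r) (W : 'M_r) :
  b != 0 -> (b^T *m c <= W)%MS -> (c <= W)%MS.
Proof.
case/rV0Pn=> j bj /row_subP/(_ j).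
rewrite (_ : row j _ = b 0 j *: c) ?(eqmx_scale _ bj) //.
by apply/rowP=> i; rewrite !mxE big_ord1 !mxE.
Qed.

Lemma tensor_spanT p s : p.1 != 0 -> p.2 != 0 -> (tensor p <= spanT s)%MS ->
  (p.1 <= spanL s)%MS /\ (p.2 <= spanR s)%MS.
Proof.
move=> p1 p2 /spanT_sub[]; rewrite mxvecK trmx_mul trmxK.
by move=> /(trmx_mul_rV p2) ? /(trmx_mul_rV p1).
Qed.

Lemma tensor_neq0 p : p.1 != 0 -> p.2 != 0 -> tensor p != 0.
Proof.
move=> p1 p2; apply/eqP=> t0; have := @tensor_spanT p [::] p1 p2.
rewrite t0 sub0mx => /(_ isT)[].
by rewrite /spanmx big_nil submx0 (negPf p1).
Qed.

(* Sylvester's rank inequality: modulo W, the relation says that a product of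
   three matrices vanishes, the middle one being diagonal and invertible. *)
Lemma relation_rank s (u : 'rV[k]_(size s)) (W : 'M_m) :
    (forall j, u 0 j != 0) -> ((vec_mx (u *m rowsmx tensor s))^T <= W)%MS ->
  (\rank (spanL s) + \rank (spanR s) <= size s + \rank (spanL s :&: W)%MS)%N.
Proof.
move=> u0; set x := vec_mx _ => xW.
pose X := rowsmx (@fst 'rV[k]_m 'rV[k]_n) s.
pose Y := rowsmx (@snd 'rV[k]_m 'rV[k]_n) s.
have xE : x^T = Y^T *m diag_mx u *m X.
  rewrite /x mulmx_sum_row linear_sum linear_sum /=; apply/matrixP=> i j.
  rewrite summxE mxE; apply: eq_bigr => l _.
  rewrite rowK linearZ /= mxvecK mul_mx_diag !mxE big_ord1 !mxE; ring.
have uU : diag_mx u \in unitmx.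
  by rewrite unitmxE det_diag unitfE; apply/prodf_neq0.
move: xW; rewrite submxE xE -mulmxA => /eqP/mulmx0_rank_max.
rewrite mxrankMfree ?row_free_unit // mxrank_tr.
have := mxrank_mul_ker X (cokermx W).
have -> : \rank (X :&: kermx (cokermx W))%MS = \rank (spanL s :&: W)%MS.
  apply: eqmx_rank; apply/eqmxP/cap_eqmx.
    exact: eqmx_sym (spanmxE _ _).
  by apply/eqmxP; rewrite submxE mulmx_ker eqxx sub_kermx mulmx_coker eqxx.
rewrite !spanmxE -/X -/Y.
by move=> <-; rewrite addnAC leq_add2r addnC.
Qed.

Definition good U : bool :=
  (\rank (spanL U) + \rank (spanR U) <= (\rank (spanT U)).+1)%N.

(* The last clause says that s' is minimal: no position j < size s' can be
   dropped. *)
Lemma minimal_relation U s : (spanT U :&: spanT s)%MS != 0 -> exists s',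
  [/\ {subset s' <= s}, (spanT U :&: spanT s')%MS != 0,
      \rank (spanT s') = size s' &
      forall j, (spanT U :&: spanT (take j s' ++ drop j.+1 s'))%MS != 0 ->
        (size s' <= j)%N].
Proof.
have [N sN] : exists N, (size s <= N)%N by exists (size s).
elim: N s sN => [|N IH] s sN s0.
  by case/negP: s0; case: s sN => // _; rewrite /spanmx big_nil capmx0.
(* A dependent [s] is replaced by a basis of its span, which is strictly shorter. *)
have [szs|] := ltnP (\rank (spanT s)) (size s).
  have [s' [s's szs' ss']] := spanmx_basis tensor s.
  have [||s'' [s''s' ? ? ?]] := IH s'.
  - by rewrite -ltnS (leq_trans _ sN) // (leq_ltn_trans szs').
  - by apply: contraNneq s0 => s'0; rewrite -submx0 -s'0 capmxS.
  by exists s''; split=> // p /s''s'/s's.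
move=> szs; have rs : \rank (spanT s) = size s.
  by apply/eqP; rewrite eqn_leq szs rank_spanmx_size.
have [/existsP[j sj]|/existsPn noj] := boolP [exists j : 'I_(size s),
    (spanT U :&: spanT (take j s ++ drop j.+1 s))%MS != 0].
  have [|s'' [s''s' ? ? ?]] := IH _ _ sj.
    rewrite -ltnS; apply: leq_trans sN.
    by rewrite size_cat size_take size_drop ltn_ord -addSn subnKC.
  exists s''; split=> // p /s''s'; rewrite mem_cat.
  by case/orP; [exact: mem_take | exact: mem_drop].
exists s; split=> // j sj; rewrite leqNgt; apply/negP=> js.
by have := noj (Ordinal js); rewrite sj.
Qed.

(** For a minimal [s'], [relation_rank] with W = [spanL U], together with a nontrivial intersection
    of [spanR s'] and [spanR U], shows that appending [s'] raises the sum of the left and right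
    ranks by at most [size s' - 1]. The tensor rank grows by at least as much: [s'] without its head
    is free and its span meets [spanT U] trivially. *)
Lemma good_extension U s : good U ->
    (forall p, p \in s -> ~~ (tensor p <= spanT U)%MS) ->
    (spanT U :&: spanT s)%MS != 0 ->
  exists s', [/\ {subset s' <= s}, good (U ++ s')
                & (\rank (spanT U) < \rank (spanT (U ++ s')))%N].
Proof.
move=> gU sU /minimal_relation[s' [s's Us' rs' mins']]; exists s'.
pose x := nz_row (spanT U :&: spanT s')%MS.
have x0 : x != 0 by rewrite nz_row_eq0.
have [xU xs'] : (x <= spanT U)%MS /\ (x <= spanT s')%MS.
  by apply/andP; rewrite -sub_capmx nz_row_sub.
have [u xE] : exists u, x = u *m rowsmx tensor s'.
  by apply/submxP; rewrite -spanmxE.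
(* A zero coefficient would let position j be dropped while x stays in both spans, against
   minimality. *)
have u0 j : u 0 j != 0.
  apply: contraT; rewrite negbK => /eqP uj0.
  suff /mins' : (spanT U :&: spanT (take j s' ++ drop j.+1 s'))%MS != 0.
    by rewrite leqNgt ltn_ord.
  apply: contraNneq x0 => U0; rewrite -submx0 -U0 sub_capmx xU xE.
  apply: row_combination_sub => l ul.
  have: l != j by apply: contraNneq ul => ->; rewrite uj0.
  rewrite (tnth_nth (tnth (in_tuple s') j)) /= mem_cat -val_eqE neq_ltn.
  case/orP=> lj; apply/orP; [left|right].
    by rewrite -(nth_take _ lj) mem_nth // size_take ltn_ord.
  rewrite -(subnKC lj) -nth_drop mem_nth // size_drop.
  exact: ltn_sub2r (leq_ltn_trans lj (ltn_ord l)) (ltn_ord l).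
have [xL xR] := spanT_sub xU; have [_ xR'] := spanT_sub xs'.
have := @relation_rank s' u (spanL U) u0; rewrite -xE => /(_ xL) leL.
(* The rows of x, seen as a nonzero matrix, lie in both right spans. *)
have ltR : (0 < \rank (spanR s' :&: spanR U)%MS)%N.
  rewrite lt0n mxrank_eq0; apply: contraNneq x0 => R0.
  rewrite -(can_eq vec_mxK) linear0 -submx0 -R0.
  by rewrite sub_capmx xR' xR.
case Es': s' => [|p s0]; first by move: Us'; rewrite Es' /spanmx big_nil capmx0 eqxx.
have Us0 : (spanT U :&: spanT s0)%MS = 0.
  by apply: contraTeq isT => Us0; have := mins' 0%N; rewrite Es' /= drop0 => /(_ Us0).
have rs0 : (size s0 <= \rank (spanT s0))%N.
  have := leq_trans (mxrank_adds_leqif <<tensor p>>%MS (spanT s0)) (leqnn _).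
  rewrite -spanmx_cons -Es' rs' Es' genmxE => /leq_trans; move: (rank_leq_row (tensor p)).
  by rewrite -(leq_add2r (\rank (spanT s0))) => le1 /(_ _ le1).
(* If [s'] were a single tensor, it would be proportional to x, hence in [spanT U]. This makes the
   growth of the tensor rank strict. *)
have s0_gt0 : (0 < size s0)%N.
  case: s0 {Us0 rs0} Es' => // Es'.
  have: ~~ (tensor p <= spanT U)%MS by rewrite sU ?s's // Es' mem_head.
  case/negP; apply: submx_trans xU.
  have /sub_rVP[a xa] : (x <= tensor p)%MS.
    apply: submx_trans xs' _.
    by rewrite Es' spanmx_sub /= submx_refl.
  have a0 : a != 0 by apply: contraNneq x0 => a0; rewrite xa a0 scale0r.
  by rewrite xa eqmx_scale.
have rT : (\rank (spanT U) + size s0 <= \rank (spanT (U ++ s')))%N.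
  apply: leq_trans (_ : \rank (spanT U + spanT s0)%MS <= _)%N.
    by rewrite mxrank_disjoint_sum // leq_add2l.
  by rewrite spanmx_cat mxrankS // addsmxS // Es' spanmx_cons addsmxSr.
split; [by rewrite -Es' | | by rewrite -Es'; apply: leq_trans rT; lia].
have arith bU bs cU cs aU a bc cc b c z : (b + bc = bs + bU -> c + cc = cs + cU ->
    bU + cU <= aU.+1 -> bs + cs <= z.+1 + bc -> 0 < cc -> aU + z <= a -> b + c <= a.+1)%N.
  lia.
rewrite -Es' /good [spanL _]spanmx_cat [spanR _]spanmx_cat.
rewrite [(spanL U + _)%MS]addsmxC [(spanR U + _)%MS]addsmxC.
apply: arith (mxrank_sum_cap _ _) (mxrank_sum_cap _ _) gU _ ltR rT.
by apply: leq_trans leL _; rewrite Es'.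
Qed.

(** As long as U is not maximal, [good_extension] strictly raises its tensor rank, which cannot
    exceed [m * n]. *)
Lemma maximal_good (P : pred pt) p : P p -> p.1 != 0 -> p.2 != 0 ->
  exists U, [/\ all P U, good U, p \in U &
    forall s, all P s -> (forall p, p \in s -> ~~ (tensor p <= spanT U)%MS) ->
      (spanT U :&: spanT s)%MS = 0].
Proof.
move=> Pp p1 p2.
pose maximal U := forall s, all P s ->
  (forall p, p \in s -> ~~ (tensor p <= spanT U)%MS) -> (spanT U :&: spanT s)%MS = 0.
have extend U : all P U -> good U -> p \in U -> ~ maximal U -> exists U',
    [/\ all P U', good U', p \in U' & (\rank (spanT U) < \rank (spanT U'))%N].
  move=> PU gU pU /not_all_ex_not[s nmax].
  have [Ps {}nmax] := imply_to_and _ _ nmax.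
  have [sU /eqP Us] := imply_to_and _ _ nmax.
  have [s' [s's gUs' rUs']] := good_extension gU sU Us.
  exists (U ++ s'); split; rewrite ?mem_cat ?pU //.
  by rewrite all_cat PU; apply/allP=> q /s's/(allP Ps).
(* N bounds the number of enlargements still possible; the start is the single tensor p. *)
suff step N U : all P U -> good U -> p \in U -> (m * n <= \rank (spanT U) + N)%N ->
    exists U', [/\ all P U', good U', p \in U' & maximal U'].
  apply: (step (m * n)%N [:: p]); rewrite ?mem_head ?leq_addl //=; first by rewrite Pp.
  rewrite /good /spanmx !big_seq1 !genmxE !rank_rV p1 p2.
  by rewrite tensor_neq0.
elim: N U => [|N IH] U PU gU pU rU.
  all: have [maxU|/(extend U PU gU pU)[U' [PU' gU' pU' ltU]]] := classic (maximal U).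
  - by exists U.
  - have := leq_trans ltU (rank_leq_col _).
    by rewrite ltnNge -[\rank (spanT U)]addn0 rU.
  - by exists U.
apply: IH PU' gU' pU' _.
by apply: leq_trans rU _; rewrite addnS -addSn leq_add2r.
Qed.

(** Induction on a bound N for the tensor ranks within P. Split off a maximal good U and keep as P'
    the tensors outside its span: by maximality their spans are independent of [spanT U], so ranks
    add, and N drops because U contains a nonzero tensor. The factors of a tensor inside the span
    lie in [spanL U] and [spanR U]. *)
Lemma good_decomposition (P : pred pt) :
    (forall p, P p -> p.1 != 0 /\ p.2 != 0) ->
  exists Us : seq (seq pt),
    [/\ all (all P) Us,
        forall U, U \in Us -> (0 < \rank (spanL U))%N && (0 < \rank (spanR U))%N,
        forall p, P p -> exists2 U, U \in Us &
          (p.1 <= spanL U)%MS && (p.2 <= spanR U)%MS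
      & (\sum_(U <- Us) (\rank (spanL U) + \rank (spanR U)).-1
           <= \rank (spanT (flatten Us)))%N].
Proof.
move=> P0.
have [N rP] : exists N, forall s, all P s -> (\rank (spanT s) <= N)%N.
  by exists (m * n)%N => s _; apply: rank_leq_col.
elim: N P P0 rP => [|N IH] P P0 rP.
  exists [::]; split=> // [p Pp|]; last by rewrite big_nil.
  have [p1 p2] := P0 p Pp; have := rP [:: p]; rewrite /= Pp => /(_ isT).
  by rewrite /spanmx big_seq1 genmxE rank_rV tensor_neq0.
have [[p0 Pp0]|noP] := classic (exists p, P p); last first.
  exists [::]; split=> // [p Pp|]; last by rewrite big_nil.
  by case: noP; exists p.
have [p1 p2] := P0 p0 Pp0; have [U [PU gU p0U maxU]] := maximal_good Pp0 p1 p2.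
pose P' p := P p && ~~ (tensor p <= spanT U)%MS.
have P'P s : all P' s -> all P s.
  by apply: sub_all => p /andP[].
have P'U s : all P' s -> (spanT U :&: spanT s)%MS = 0.
  by move=> P's; apply: maxU (P'P s P's) _ => p /(allP P's)/andP[].
have rank_cat s : all P' s ->
    \rank (spanT (U ++ s)) = (\rank (spanT U) + \rank (spanT s))%N.
  by move=> P's; rewrite spanmx_cat mxrank_disjoint_sum // P'U.
have rU q (f : pt -> 'rV[k]_q) : f p0 != 0 -> (0 < \rank (spanmx f U))%N.
  move=> fp0; have := mxrankS (mem_spanmx f p0U).
  by rewrite rank_rV fp0.
have [|s P's|Us [P'Us Us0 covUs rUs]] := IH P'.
- by move=> p /andP[/P0].
- have := rP (U ++ s); rewrite all_cat PU P'P // rank_cat // => /(_ isT).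
  apply: contraTT; rewrite -!ltnNge => lt.
  by rewrite -add1n leq_add // rU // tensor_neq0.
have P'f : all P' (flatten Us).
  by apply/allP=> p /flattenP[V /(allP P'Us)/allP]; apply.
exists (U :: Us); split.
- by rewrite /= PU; apply: sub_all P'Us => s; apply: P'P.
- by move=> V; rewrite inE => /predU1P[->|/Us0//]; rewrite !rU.
- move=> p Pp; have [pU|pU] := boolP (tensor p <= spanT U)%MS.
    exists U; first exact: mem_head.
    by have [q1 q2] := P0 p Pp; apply/andP; apply: tensor_spanT.
  have [|V VUs pV] := covUs p; first by rewrite /P' Pp.
  by exists V => //; rewrite inE VUs orbT.
rewrite big_cons /= rank_cat // leq_add //.
by move: gU; rewrite /good; case: (_ + _)%N.
Qed.

End Tensors.

(** * Counting dimensions over the decomposition *)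

(** If one subspace is the whole space, each of the others still adds at least 1 to the sum;
    otherwise [covering_rank] gives the doubled bound. *)
Lemma covering_family_rank (k : fieldType) (q : nat) (J : eqType) (Us : seq J)
    (S : J -> 'M[k]_q) : (0 < q)%N ->
    (forall U, U \in Us -> (0 < \rank (S U))%N) ->
    (forall v : 'rV_q, v != 0 -> exists2 U, U \in Us & (v <= S U)%MS) ->
  let r := (\sum_(U <- Us) \rank (S U))%N in
  [/\ (q <= r)%N, (size Us <= r)%N & (q + size Us <= r.+1)%N || (2 * q <= r.+1)%N].
Proof.
move=> q0 S0 covS r.
have rest U : U \in Us -> (\rank (S U) + (size Us).-1 <= r)%N.
  move=> UUs; rewrite /r (big_rem U UUs) leq_add2l -(size_rem UUs) -sum1_size.
  rewrite big_seq [X in (_ <= X)%N]big_seq; apply: leq_sum => V /mem_rem.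
  exact: S0.
have I0 : (1%:M : 'M[k]_q) != 0 by rewrite -mxrank_eq0 mxrank1 -lt0n.
have [v _ v0|[_ /mapP[U UUs ->] IU]|] := @covering_rank _ _ _ [seq S U | U <- Us] I0.
- by have [U UUs vU] := covS v v0; exists (S U) => //; apply: map_f.
- have := mxrankS IU; rewrite mxrank1; have := rest U UUs.
  have : (0 < size Us)%N by case: (Us) UUs.
  by move=> *; split; lia.
rewrite big_map mxrank1 -/r => le2; split; last by rewrite le2 orbT.
  by lia.
rewrite /r -sum1_size big_seq [X in (_ <= X)%N]big_seq; exact: leq_sum.
Qed.

Lemma rank_covering_tensors (k : fieldType) (m n : nat)
    (P : pred ('rV[k]_m * 'rV[k]_n)) : (0 < m)%N -> (0 < n)%N ->
    (forall p, P p -> p.1 != 0 /\ p.2 != 0) ->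
    (forall b, b != 0 -> exists c, P (b, c)) ->
    (forall c, c != 0 -> exists b, P (b, c)) ->
  exists2 s, all P s & (m + n - 1 <= \rank (spanmx (@tensor k m n) s))%N.
Proof.
move=> m0 n0 P0 covL covR; have [Us [PUs Us0 covUs rUs]] := good_decomposition P0.
exists (flatten Us).
  by apply/allP=> p /flattenP[U /(allP PUs)/allP]; apply.
apply: leq_trans rUs.
pose L U := spanmx (@fst 'rV[k]_m 'rV[k]_n) U.
pose R U := spanmx (@snd 'rV[k]_m 'rV[k]_n) U.
have [||le_mL le_sL caseL] := @covering_family_rank _ _ _ Us L m0.
- by move=> U /Us0/andP[].
- by move=> b /covL[c /covUs[U UUs /andP[bU _]]]; exists U.
have [||le_nR le_sR caseR] := @covering_family_rank _ _ _ Us R n0.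
- by move=> U /Us0/andP[].
- by move=> c /covR[b /covUs[U UUs /andP[_ cU]]]; exists U.
have Esum : (\sum_(U <- Us) (\rank (L U) + \rank (R U)).-1 + size Us =
    \sum_(U <- Us) \rank (L U) + \sum_(U <- Us) \rank (R U))%N.
  rewrite -sum1_size -!big_split; apply: eq_big_seq => U /Us0/andP[L0 R0] /=.
  by rewrite addn1 prednK // addn_gt0 L0.
(* When both doubled bounds hold, [h <= r] gives t >= l >= 2m - 1 and [h <= l] gives t >= r >= 2n -
   1; the larger one suffices. *)
have arith l r h t : (m <= l -> h <= l -> (m + h <= l.+1) || (2 * m <= l.+1) ->
    n <= r -> h <= r -> (n + h <= r.+1) || (2 * n <= r.+1) ->
    t + h = l + r -> m + n - 1 <= t)%N.
  by lia.
exact: arith le_mL le_sL caseL le_nR le_sR caseR Esum.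
Qed.

(** * Transfer from matrices to an arbitrary tensor product *)

Theorem proposition1 (k : fieldType) (B C T : vectType k)
    (tens : {bilinear B -> C -> T}) (tensP : is_tensor_product tens)
    (B_neq0 : ({:B} != 0)%VS) (C_neq0 : ({:C} != 0)%VS)
    (A : {vspace T})
    (hB : forall b : B, b != 0 -> exists c : C, c != 0 /\ tens b c \in A)
    (hC : forall c : C, c != 0 -> exists b : B, b != 0 /\ tens b c \in A) :
  (\dim A >= \dim {:B} + \dim {:C} - 1)%N.
Proof.
(* The universal property sends T linearly to matrices; a linear image of A has dimension at most
   [\dim A], so it is enough to bound the rank there. *)
have [g [gE _]] := tensP _ (@tens_mx k B C).
pose vecB (v : 'rV[k]_(\dim {:B})) := \sum_i v 0 i *: (vbasis {:B})`_i.
pose vecC (v : 'rV[k]_(\dim {:C})) := \sum_i v 0 i *: (vbasis {:C})`_i.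
have vec_tens v w : mxvec (g (tens (vecB v) (vecC w))) = tensor (v, w).
  rewrite gE /tensor; congr mxvec; apply/matrixP=> i j.
  rewrite !mxE big_ord1 !mxE /vecB /vecC.
  by rewrite !coord_sum_free ?(basis_free (vbasisP _)).
pose P (p : 'rV[k]_(\dim {:B}) * 'rV[k]_(\dim {:C})) :=
  [&& p.1 != 0, p.2 != 0 & tens (vecB p.1) (vecC p.2) \in A].
have vecBK b : vecB (\row_i coord (vbasis {:B}) i b) = b.
  by rewrite [RHS](coord_vbasis (memvf b)); apply: eq_bigr => i _; rewrite mxE.
have vecCK c : vecC (\row_i coord (vbasis {:C}) i c) = c.
  by rewrite [RHS](coord_vbasis (memvf c)); apply: eq_bigr => i _; rewrite mxE.
have vecB0 v : (vecB v == 0) = (v == 0).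
  apply/eqP/eqP=> [v0|->]; last by apply: big1 => i _; rewrite mxE scale0r.
  apply/rowP=> i; rewrite mxE -(coord_sum_free (v 0) i (basis_free (vbasisP {:B}))).
  by rewrite -/(vecB v) v0 linear0.
have vecC0 v : (vecC v == 0) = (v == 0).
  apply/eqP/eqP=> [v0|->]; last by apply: big1 => i _; rewrite mxE scale0r.
  apply/rowP=> i; rewrite mxE -(coord_sum_free (v 0) i (basis_free (vbasisP {:C}))).
  by rewrite -/(vecC v) v0 linear0.
have [||p|b b0|c c0|s Ps] := @rank_covering_tensors _ _ _ P.
- by rewrite lt0n dimv_eq0.
- by rewrite lt0n dimv_eq0.
- by case/and3P.
- have [|c [c0 bcA]] := hB (vecB b); first by rewrite vecB0.
  exists (\row_i coord (vbasis {:C}) i c).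
  by rewrite /P /= b0 -vecC0 vecCK c0.
- have [|b [b0 bcA]] := hC (vecC c); first by rewrite vecC0.
  exists (\row_i coord (vbasis {:B}) i b).
  by rewrite /P /= c0 -vecB0 vecBK b0.
move/leq_trans; apply.
(* The [\dim A] rows of M span the image of A, which contains the tensors of [s]. *)
pose M := \matrix_(i < \dim A) mxvec (g (vbasis A)`_i).
apply: leq_trans (rank_leq_row M); apply: mxrankS; rewrite spanmx_sub.
apply/allP=> -[v w] /(allP Ps)/and3P[_ _ vwA].
rewrite -vec_tens (coord_vbasis vwA) !linear_sum summx_sub // => i _.
rewrite !linearZ scalemx_sub //=.
by rewrite -[mxvec _](rowK (fun i => mxvec (g (vbasis A)`_i))) row_sub.
Qed.
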